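(* Let $\Gamma=\mathbb{Z}\omega_1+\mathbb{Z}\omega_2$ be a full-rank oriented lattice in $\mathbb{C}$, $\nu>0$, and let $\chi$ be a pseudo-character on $\Gamma$ (relative to $\nu$). Let $K=K^{\nu}_{\Gamma,\chi}$ be the reproducing kernel function of the theta Bargmann-Fock space $\mathcal{O}^{\nu}_{\Gamma,\chi}(\mathbb{C})$, let $\mathcal{Z}(K)\subset\mathbb{C}\times\mathbb{C}$ be its set of zeros, and put $\varphi_w(z):=K(z,w)$. The set $\mathcal{Z}(K)$ is symmetric and is given by $$\mathcal{Z}(K)=\bigcup_{w\in\Lambda(\Gamma)}\Big(\big(\mathcal{Z}(\varphi_w|_{\Lambda(\Gamma)})+\Gamma\big)\times\{w\}\Big)\ \cup\ \bigcup_{w\in\Lambda(\Gamma)}\Big(\{w\}\times\big(\mathcal{Z}(\varphi_w|_{\Lambda(\Gamma)})+\Gamma\big)\Big),$$ where $\mathcal{Z}(\varphi_w|_{\Lambda(\Gamma)})$ denotes the set of zeros of the function $\varphi_w$ contained in an arbitrary fundamental cell $\Lambda(\Gamma)$. Moreover, the analytic set (the set of common zeros) of the theta Bargmann-Fock space, $\bigcap_{f\in\mathcal{O}^{\nu}_{\Gamma,\chi}(\mathbb{C})}\mathcal{Z}(f|_{\Lambda(\Gamma)})$, reduces to $$\Xi:=\{\widetilde{w}\in\Lambda(\Gamma):\ \varphi_{\widetilde{w}}\equiv 0\text{ on }\Lambda(\Gamma)\}.$$ This set $\Xi$ is finite and its cardinality is less than or equal to the dimension of $\mathcal{O}^{\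nu}_{\Gamma,\chi}(\mathbb{C})$.
   Context: Here $\omega_1,\omega_2$ are linearly independent over $\mathbb{R}$. $\Lambda(\Gamma)$ denotes a fundamental cell, i.e. any compact fundamental region for $\Gamma\backslash\mathbb{C}$. For a function $f$ on $\mathbb{C}$, $\mathcal{Z}(f|_{\Lambda(\Gamma)})$ is the set of zeros of $f$ in $\Lambda(\Gamma)$. A subset $Z$ of $\mathbb{C}\times\mathbb{C}$ is symmetric if $(z,w)\in Z$ implies $(w,z)\in Z$. Pseudo-character: a map $\chi:\Gamma\to\{|\zeta|=1\}\subset\mathbb{C}$ with $\chi(\gamma+\gamma')=\chi(\gamma)\chi(\gamma')e^{\frac{\nu}{2}(\gamma\overline{\gamma'}-\overline{\gamma}\gamma')}$ for all $\gamma,\gamma'\in\Gamma$. Space: $\mathcal{O}^{\nu}_{\Gamma,\chi}(\mathbb{C})$ is the space of holomorphic functions $f$ on $\mathbb{C}$ with $f(z+\gamma)=\chi(\gamma)e^{\nu(z+\frac{\gamma}{2})\overline{\gamma}}f(z)$ for all $z\in\mathbb{C}$, $\gamma\in\Gamma$, equipped with $\langle f,g\rangle=\int_{\Lambda(\Gamma)}f(z)\overline{g(z)}e^{-\nu|z|^2}dm(z)$, $dm$ being Lebesgue measure. It is a finite-dimensional reproducing kernel Hilbert space. Kernel: the reproducing kernel function of this space is $$K^{\nu}_{\Gamma,\chi}(z,w)=\frac{\nu}{\pi}\sum_{\gamma\in\Gamma}\chi(\gamma)e^{-\frac{\nu}{2}|\gamma|^2+\nu(z\overline{\gamma}-\overline{w}\gamma+z\overline{w})},$$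 the series converging absolutely and uniformly on compact subsets of $\mathbb{C}\times\mathbb{C}$.
   Formalization: The formula for Z(K), false as printed, is proved for pairs with a coordinate in Λ(Γ), and for all of Z(K) after translating both coordinates by Γ; the bound on the cardinality of Ξ counts its points modulo Γ, as equivalent boundary points of a compact cell can break the literal bound. *)

(* Defs.v *)
From HB Require Import structures.
From mathcomp Require Import all_boot all_order all_algebra.
From mathcomp Require Import complex.
From mathcomp Require Import all_classical all_reals all_analysis.

Set Implicit Arguments.
Unset Strict Implicit.
Unset Printing Implicit Defensive.

Import Order.TTheory GRing.Theory Num.Theory.
Import numFieldNormedType.Exports.

Local Open Scope classical_set_scope.
Local Open Scope ring_scope.

Section Complex.
Context {R : realType}.
Local Notation C := (R[i]).

Definition cexp (z : C) : C :=
  Complex (expR (complex.Re z) * cos (complex.Im z))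
          (expR (complex.Re z) * sin (complex.Im z)).

(* [derivable] over the scalar field C, in the direction 1, is complex
   differentiability. *)
Definition entire (f : C -> C) : Prop :=
  forall z : C, derivable (f : C^o -> C^o) z 1.

Definition planar_measure : {measure
    set (measurableTypeR R * measurableTypeR R) -> \bar R} :=
  (@lebesgue_measure R \x @lebesgue_measure R)%E.

Definition to_plane (A : set C) : set (R * R) :=
  [set p | A (Complex p.1 p.2)].

Definition cintegral (A : set C) (f : C -> C) : C :=
  Complex
    (\int[planar_measure]_(p in to_plane A)
       complex.Re (f (Complex p.1 p.2)))
    (\int[planar_measure]_(p in to_plane A)
       complex.Im (f (Complex p.1 p.2))).

(* The C-vector space [E] of functions has dimension [d]: it has a basis with
   [d] elements. *)
Definition has_dimension (E : set (C -> C)) (d : nat) : Prop :=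
  exists e : 'I_d -> C -> C,
    [/\ forall i, E (e i),
        forall c : 'I_d -> C,
          (forall z, \sum_(i < d) c i * e i z = 0) -> forall i, c i = 0
      & forall f, E f ->
          exists c : 'I_d -> C, forall z, f z = \sum_(i < d) c i * e i z].

End Complex.

Section ThetaBargmannFock.
Context {R : realType}.
Local Notation C := (R[i]).

Definition R_independent (w1 w2 : C) : Prop :=
  forall a b : R, a%:C%C * w1 + b%:C%C * w2 = 0 -> a = 0 /\ b = 0.

Definition lattice (w1 w2 : C) : set C :=
  [set x | exists m n : int, x = w1 *~ m + w2 *~ n].

Definition msum (A B : set C) : set C := [set a + b | a in A & b in B].

(* A compact fundamental region of C modulo [Gamma]: its translates cover C and
   overlap only in Lebesgue-null sets.  A compact region cannot be a strict set
   of representatives, so distinct boundary points may be equivalent. *)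
Definition fundamental_cell (Gamma Lambda : set C) : Prop :=
  [/\ compact (Lambda : set C^o),
      msum Lambda Gamma = setT
    & forall gamma, Gamma gamma -> gamma != 0 ->
        planar_measure (to_plane (Lambda `&` msum Lambda [set gamma])) = 0%E].

Definition pseudo_character (nu : R) (Gamma : set C) (chi : C -> C) : Prop :=
  (forall gamma, Gamma gamma -> `|chi gamma| = 1) /\
  (forall gamma gamma', Gamma gamma -> Gamma gamma' ->
     chi (gamma + gamma') = chi gamma * chi gamma' *
       cexp (nu%:C%C / 2 * (gamma * conjc gamma' - conjc gamma * gamma'))).

Definition theta_space (nu : R) (Gamma : set C) (chi : C -> C) :
    set (C -> C) :=
  [set f | entire f /\
     forall z gamma, Gamma gamma ->
       f (z + gamma) =
         chi gamma * cexp (nu%:C%C * (z + gamma / 2) * conjc gamma) * f z].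

Definition theta_inner (nu : R) (Lambda : set C) (f g : C -> C) : C :=
  cintegral Lambda (fun z =>
    f z * conjc (g z) * cexp (- (nu%:C%C * `|z| ^+ 2))).

(* The integrand is [Gamma]-invariant on [theta_space], so the inner product,
   and hence the unique reproducing kernel, does not depend on [Lambda]. *)
Definition reproducing_kernel (nu : R) (Gamma : set C) (chi : C -> C)
    (Lambda : set C) (K : C -> C -> C) : Prop :=
  (forall w, theta_space nu Gamma chi (fun z => K z w)) /\
  (forall f w, theta_space nu Gamma chi f ->
     f w = theta_inner nu Lambda f (fun z => K z w)).

Definition zeros (f : C -> C) : set C := [set z | f z = 0].

Definition zeros_in (Lambda : set C) (f : C -> C) : set C :=
  Lambda `&` zeros f.

Definition kernel_zeros (K : C -> C -> C) : set (C * C) :=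
  [set p | K p.1 p.2 = 0].

Definition symmetric_set (Z : set (C * C)) : Prop :=
  forall z w, Z (z, w) -> Z (w, z).

(* At least one coordinate of each of these pairs lies in [Lambda]; the zeros of
   the kernel are invariant under independent [Gamma]-translations of both
   coordinates, hence [saturation] below. *)
Definition kernel_zeros_from_cell (Gamma Lambda : set C) (K : C -> C -> C) :
    set (C * C) :=
  \bigcup_(w in Lambda)
     (msum (zeros_in Lambda (fun z => K z w)) Gamma `*` [set w]) `|`
  \bigcup_(w in Lambda)
     ([set w] `*` msum (zeros_in Lambda (fun z => K z w)) Gamma).

Definition saturation (Gamma : set C) (Z : set (C * C)) : set (C * C) :=
  [set p | exists q, Z q /\
     exists gamma gamma', [/\ Gamma gamma, Gamma gamma'
       & p = (q.1 + gamma, q.2 + gamma')]].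

Definition analytic_set (Lambda : set C) (E : set (C -> C)) : set C :=
  \bigcap_(f in E) zeros_in Lambda f.

Definition Xi (Lambda : set C) (K : C -> C -> C) : set C :=
  [set w | Lambda w /\ forall z, Lambda z -> K z w = 0].

(* Used to count points of a cell without counting several times a boundary
   point that has equivalent copies in the cell. *)
Definition classes_mod (Gamma A : set C) : set (set C) :=
  [set msum [set w] Gamma | w in A].

End ThetaBargmannFock.

(* Main.v *)
Require Import Defs.
From mathcomp Require Import all_boot all_order all_algebra.
From mathcomp Require Import complex ring lra.
From mathcomp Require Import all_classical all_reals all_analysis.

(* If all elements of the theta space vanish at a point then so does the kernel
   there, and the reproducing property gives the converse; Hermitian symmetry of
   the kernel, read off from the inner product, yields the rest of the
   description of its zeros.

   For the size of [Xi] it suffices to have theta functions with known zeros.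
   Consistency of the pseudo-character forces nu * area / pi to be an integer n,
   and n >= 1.  The Jacobi product sigma vanishes on the lattice only and is
   quasi-periodic, so that exp(alpha z^2 + beta z) sigma(z - a_1) ...
   sigma(z - a_n) belongs to the theta space as soon as a_1 + ... + a_n has a
   prescribed value s.  With a_2 = ... = a_n = t and a_1 = s - (n - 1) t, varying
   t shows that the common zeros form at most one class modulo the lattice, and
   that the dimension is positive. *)

Set Implicit Arguments.
Unset Strict Implicit.
Unset Printing Implicit Defensive.
Import Order.TTheory GRing.Theory Num.Theory.
Import numFieldNormedType.Exports.
Import ComplexField.
Local Open Scope classical_set_scope.
Local Open Scope ring_scope.

(** * Modulus and exponential *)


Section ComplexModulus.
Context {R : realType}.
Local Notation C := (R[i]).
Local Notation nc := (@Normc.normc R).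
Implicit Types x y z : C.

Lemma ncE z : `|z| = (nc z)%:C%C. Proof. by []. Qed.

Lemma nc_ge0 z : 0 <= nc z.
Proof. by rewrite -ler0c -ncE. Qed.

Lemma ncD x y : nc (x + y) <= nc x + nc y.
Proof. exact: le_normcD. Qed.

Lemma ncN x : nc (- x) = nc x.
Proof. exact: normcN. Qed.

Lemma ncX x n : nc (x ^+ n) = nc x ^+ n.
Proof. by elim: n => [|n IH]; rewrite ?Normc.normc1// !exprS Normc.normcM IH. Qed.

Lemma nc_eq0 x : (nc x == 0) = (x == 0).
Proof.
apply/eqP/eqP => [/Normc.eq0_normc //|->]; exact: Normc.normc0.
Qed.

Lemma nc_gt0 x : (0 < nc x) = (x != 0).
Proof. by rewrite lt_neqAle nc_ge0 andbT eq_sym nc_eq0. Qed.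

Lemma nc_real (a : R) : nc a%:C%C = `|a|.
Proof. by rewrite /= expr0n addr0 sqrtr_sqr. Qed.

Lemma nc_nat n : nc n%:R = n%:R.
Proof. by rewrite -(rmorph_nat (real_complex R)) nc_real normr_nat. Qed.

Lemma normr_Re_le z : `|complex.Re z| <= nc z.
Proof. by rewrite -lecR -ncE; exact: normc_ge_Re. Qed.

Lemma normr_Im_le z : `|complex.Im z| <= nc z.
Proof.
case: z => a b /=; rewrite -[leLHS]sqrtr_sqr ler_wsqrtr//.
by rewrite lerDr sqr_ge0.
Qed.

Lemma nc_le_ReIm z : nc z <= `|complex.Re z| + `|complex.Im z|.
Proof.
case: z => a b /=; rewrite -[leRHS]ger0_norm ?addr_ge0//.
rewrite -sqrtr_sqr ler_wsqrtr// sqrrD !real_normK ?num_real//.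
by rewrite addrAC lerDl mulrn_wge0// mulr_ge0.
Qed.

End ComplexModulus.

Section ComplexExponential.
Context {R : realType}.
Local Notation C := (R[i]).
Local Notation nc := (@Normc.normc R).
Implicit Types x y z : C.

Lemma cexp0 : cexp 0 = 1 :> C.
Proof. by rewrite /cexp /= expR0 cos0 sin0 mulr1 mulr0. Qed.

Lemma cexpD x y : cexp (x + y) = cexp x * cexp y.
Proof.
case: x y => [a b] [c d]; apply/eqP; rewrite eq_complex /= expRD cosD sinD.
by apply/andP; split; apply/eqP; ring.
Qed.

Lemma nc_cexp z : nc (cexp z) = expR (complex.Re z).
Proof.
case: z => a b; rewrite /cexp /= !exprMn -mulrDr cos2Dsin2 mulr1.
by rewrite sqrtr_sqr ger0_norm// expR_ge0.
Qed.

Lemma cexp_neq0 z : cexp z != 0.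
Proof. by rewrite -nc_eq0 nc_cexp gt_eqF// expR_gt0. Qed.

Lemma cexpN z : cexp (- z) = (cexp z)^-1.
Proof.
apply: (mulfI (cexp_neq0 z)).
by rewrite -cexpD subrr cexp0 divff// cexp_neq0.
Qed.

Lemma cexpMn z n : cexp (z *+ n) = cexp z ^+ n.
Proof. by elim: n => [|n IH]; rewrite ?cexp0// mulrS exprS cexpD IH. Qed.

(** Polar coordinates: the angle comes from [acos], negated when the sine is negative because [acos]
    takes values in [0, pi] only. *)
Lemma cexp_surj z : z != 0 -> exists x, cexp x = z.
Proof.
rewrite -nc_gt0; case: z => a b; set r := nc _ => r0.
have r2 : a ^+ 2 + b ^+ 2 = r ^+ 2 by rewrite sqr_sqrtr// addr_ge0 ?sqr_ge0.
have ab : (a / r) ^+ 2 + (b / r) ^+ 2 = 1.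
  by rewrite !expr_div_n -mulrDl r2 divff// expf_neq0// gt_eqF.
have ar : -1 <= a / r <= 1.
  by rewrite -ler_norml -(@expr_le1 _ 2)// real_normK ?num_real// -ab lerDl sqr_ge0.
have [t [ct st]] : exists t, cos t = a / r /\ sin t = b / r.
  have sq : Num.sqrt (1 - (a / r) ^+ 2) = `|b / r|.
    by rewrite -ab addrAC subrr add0r sqrtr_sqr.
  have [b0|b0] := leP 0 (b / r).
    by exists (acos (a / r)); rewrite sin_acos// acosK ?itv_boundlr//= sq ger0_norm.
  exists (- acos (a / r)).
  by rewrite cosN sinN sin_acos// acosK ?itv_boundlr//= sq ltr0_norm// opprK.
exists (Complex (ln r) t); rewrite /cexp /= lnK ?posrE// ct st.
by rewrite !(mulrC r) !divfK ?gt_eqF//.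
Qed.

Lemma cos_sin_2pi_int (k : int) (x : R) :
  cos (x + 2 * pi * k%:~R) = cos x /\ sin (x + 2 * pi * k%:~R) = sin x.
Proof.
have H n (y : R) : cos (y + 2 * pi * n%:R) = cos y /\ sin (y + 2 * pi * n%:R) = sin y.
  rewrite mulr_natr [2 * pi]mulr_natl.
  by rewrite (periodicn (@cosD2pi R)) (periodicn (@sinD2pi R)).
case: (intP k) => [|n|n].
- by rewrite mulr0 addr0.
- exact: H.
- by rewrite rmorphN mulrN -{2 4}[x](subrK (2 * pi * n.+1%:R)) !(H n.+1 _).1 !(H n.+1 _).2.
Qed.

(** Reduce [x] to [y] in [0, 2 pi). If [y] were positive, [y / 2] would lie in (0, pi), where the
    sine is positive, and cos y = 1 - 2 sin^2 (y / 2) would be less than 1. *)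
Lemma cos_eq1 (x : R) : cos x = 1 -> exists k : int, x = 2 * pi * k%:~R.
Proof.
have pi0 : 0 < 2 * pi :> R by rewrite mulr_gt0// pi_gt0.
move=> cx; exists (Num.floor (x / (2 * pi))); set k := Num.floor _.
have /andP[k1 k2] : k%:~R <= x / (2 * pi) < (k + 1)%:~R.
  by rewrite floor_le_tmp floorD1_gt.
pose y := x - 2 * pi * k%:~R.
have xE : x = y + 2 * pi * k%:~R by rewrite subrK.
suff y0 : y = 0 by rewrite xE y0 add0r.
have y_ge0 : 0 <= y by rewrite subr_ge0 mulrC -ler_pdivlMr.
have y_lt : y < 2 * pi.
  by rewrite ltrBlDr -{1}[2 * pi]mulr1 -mulrDr mulrC -ltr_pdivrMr// addrC -(intrD _ k 1).
move: cx; rewrite xE (cos_sin_2pi_int k y).1 => cy.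
apply/eqP; rewrite eq_le y_ge0 andbT leNgt; apply/negP => y_gt0.
have s0 : 0 < sin (y / 2) by apply: sin_gt0_pi; lra.
have := cos_mulr2n (y / 2); rewrite -[y / 2 *+ 2]mulr_natr divfK// cy cos2sin2.
have : 0 < sin (y / 2) ^+ 2 by rewrite exprn_gt0.
set s := _ ^+ 2; rewrite -mulr_natr; lra.
Qed.

Lemma cexp_eq1 z : cexp z = 1 -> exists k : int, z = Complex 0 (2 * pi * k%:~R).
Proof.
move=> e1; have := nc_cexp z; rewrite e1 Normc.normc1 => /esym re.
case: z e1 re => a b /= e1 re.
have a0 : a = 0 by rewrite -[a]expRK re ln1.
move: e1; rewrite /cexp /= a0 expR0 !mul1r => -[/cos_eq1[k ->] _].
by exists k.
Qed.

Lemma cexp_2pi_int (k : int) : cexp (Complex 0 (2 * pi * k%:~R)) = 1 :> C.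
Proof.
rewrite /cexp /= expR0 !mul1r.
have := cos_sin_2pi_int k 0; rewrite add0r cos0 sin0 => -[-> ->] //.
Qed.

End ComplexExponential.

(** * Entire functions *)

Section Differentiability.
Context {R : realType}.
Local Notation C := (R[i]).
Local Notation nc := (@Normc.normc R).

(** A division-free form with real epsilon and delta, so that the estimates are inequalities in
    [R]. *)
Definition has_cderiv (f : C -> C) (z l : C) : Prop :=
  forall e : R, 0 < e -> exists2 d : R, 0 < d &
    forall h : C, nc h < d -> nc (f (z + h) - f z - l * h) <= e * nc h.

Lemma has_cderiv_derivable f z l :
  has_cderiv f z l -> derivable (f : C^o -> C^o) z 1.
Proof.
move=> fl; apply/cvg_ex; exists (l : C^o).
apply/cvgrPdist_le => e e0.
(* The norm topology quantifies over a positive [e] in [C]; such an element is real. *)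
have [e' e'0 ee'] : exists2 e' : R, 0 < e' & e = e'%:C%C.
  have er : e \is Num.real by rewrite gtr0_real.
  by exists (complex.Re e); rewrite -?ltcR RRe_real.
have [d d0 H] := fl e' e'0.
apply/nbhs_ballP; exists (d%:C%C) => /=; first by rewrite ltcR.
move=> h; rewrite /ball /= sub0r normrN ncE ltcR => hd hn0.
rewrite ee' ncE lecR.
have -> : l - h^-1 *: (f (h *: 1 + z) - f z) = - (h^-1 * (f (z + h) - f z - l * h)).
  by rewrite [h *: 1]mulr1 [h + z]addrC /GRing.scale /=; field.
rewrite ncN Normc.normcM Normc.normcV mulrC ler_pdivrMr ?nc_gt0//.
exact: H.
Qed.

Lemma is_derive0_approx (f : R -> R) (l : R) : is_derive (0 : R) (1 : R) f l ->
  forall e : R, 0 < e -> exists2 d : R, 0 < d &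
    forall h : R, `|h| < d -> `|f h - f 0 - l * h| <= e * `|h|.
Proof.
move=> [df dl] e e0.
have : (fun h : R => h^-1 *: ((f \o shift 0) (h *: 1) - f 0)) @ 0^' --> l.
  by rewrite -dl; exact: df.
move=> /cvgrPdist_le /(_ e e0) /nbhs_ballP[d /= d0 H].
exists d => // h hd; have [->|hn0] := eqVneq h 0.
  by rewrite subrr sub0r mulr0 oppr0 normr0 mulr0.
have := H h; rewrite /ball /= sub0r normrN => /(_ hd hn0).
rewrite addr0 [h *: 1]mulr1 => H1.
have -> : f h - f 0 - l * h = - ((l - h^-1 *: (f h - f 0)) * h).
  by rewrite /GRing.scale /=; field.
by rewrite normrN normrM ler_wpM2r.
Qed.

Lemma has_cderiv_cexp0 : has_cderiv cexp 0 1.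
Proof.
move=> e e0.
(* The real part of the remainder costs [3 * e' * n] and the imaginary part [5 * e' * n], whence the
   8. *)
have e'0 : 0 < Num.min (e / 8) 1 by rewrite lt_min ltr01 andbT divr_gt0.
set e' := Num.min _ _ in e'0.
have e'e : e' <= e / 8 by rewrite ge_min lexx.
have e'1 : e' <= 1 by rewrite ge_min lexx orbT.
clearbody e'.
have de : is_derive (0 : R) (1 : R) expR 1.
  by have := is_derive_expR (0 : R); rewrite expR0.
have dc : is_derive (0 : R) (1 : R) cos 0.
  by have := is_derive_cos (0 : R); rewrite sin0 oppr0.
have ds : is_derive (0 : R) (1 : R) sin 1.
  by have := is_derive_sin (0 : R); rewrite cos0.
have [d1 d10 H1] := is_derive0_approx de e'0.
have [d2 d20 H2] := is_derive0_approx dc e'0.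
have [d3 d30 H3] := is_derive0_approx ds e'0.
(* Having [e'] in the minimum makes the product [(expR a - 1) * sin b] of order [e' * n]. *)
pose d := Num.min e' (Num.min d1 (Num.min d2 d3)).
exists d; first by rewrite !lt_min e'0 d10 d20 d30.
move=> h; rewrite !lt_min => /and4P[he h1 h2 h3].
apply: (le_trans (nc_le_ReIm _)).
have a_h := normr_Re_le h; have b_h := normr_Im_le h.
rewrite add0r cexp0 mul1r.
case: h a_h b_h he h1 h2 h3 => a b; set n := nc _ => /= a_h b_h he h1 h2 h3.
have {H1}:= H1 a (le_lt_trans a_h h1).
have {H2}:= H2 b (le_lt_trans b_h h2).
have {H3}:= H3 b (le_lt_trans b_h h3).
rewrite expR0 cos0 sin0 !mul1r mul0r !subr0 => Hs Hc He.
have n0 : 0 <= n by rewrite (le_trans _ a_h).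
have cb := cos_max b.
have Re_le : `|expR a * cos b - 1 - a| <= 3 * e' * n.
  have -> : expR a * cos b - 1 - a =
    (expR a - 1 - a) * cos b + (1 + a) * (cos b - 1) by ring.
  apply: (le_trans (ler_normD _ _)); rewrite !normrM.
  have : `|expR a - 1 - a| * `|cos b| <= e' * n * 1.
    by rewrite ler_pM// (le_trans He)// ler_wpM2l// ltW.
  have : `|1 + a| * `|cos b - 1| <= 2 * (e' * n).
    rewrite ler_pM//; last by rewrite (le_trans Hc)// ler_wpM2l// ltW.
    by rewrite (le_trans (ler_normD _ _))// normr1 (le_trans (lerD (lexx _) a_h))//; lra.
  lra.
have Im_le : `|expR a * sin b - b| <= 5 * e' * n.
  have -> : expR a * sin b - b = (expR a - 1) * sin b + (sin b - b) by ring.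
  apply: (le_trans (ler_normD _ _)); rewrite !normrM.
  have Hs' : `|sin b - b| <= e' * n by rewrite (le_trans Hs)// ler_wpM2l// ltW.
  have en : e' * n <= n by rewrite -[leRHS]mul1r ler_wpM2r.
  have : `|expR a - 1| * `|sin b| <= (2 * e') * (2 * n).
    rewrite ler_pM//.
      have -> : expR a - 1 = (expR a - 1 - a) + a by ring.
      apply: (le_trans (ler_normD _ _)).
      have : e' * `|a| <= e' * 1 by rewrite ler_wpM2l ?ltW//; lra.
      lra.
    have -> : sin b = (sin b - b) + b by ring.
    apply: (le_trans (ler_normD _ _)); lra.
  lra.
apply: (le_trans (lerD Re_le Im_le)).
have : e' * n <= e / 8 * n by rewrite ler_wpM2r.
lra.
Qed.

Lemma has_cderiv_cexp z : has_cderiv cexp z (cexp z).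
Proof.
move=> e e0; have nz : 0 < nc (cexp z) by rewrite nc_gt0 cexp_neq0.
have [d d0 H] := has_cderiv_cexp0 (divr_gt0 e0 nz).
exists d => // h /H; rewrite add0r cexp0 mul1r => {}H.
have -> : cexp (z + h) - cexp z - cexp z * h = (cexp h - 1 - h) * cexp z.
  by rewrite cexpD; ring.
by rewrite Normc.normcM -ler_pdivlMr// mulrAC.
Qed.

Lemma entire_cexp : entire (@cexp R).
Proof. by move=> z; exact: has_cderiv_derivable (has_cderiv_cexp z). Qed.

Lemma entireM (f g : C -> C) : entire f -> entire g -> entire (fun z => f z * g z).
Proof. by move=> df dg z; exact: (derivableM (df z) (dg z)). Qed.

Lemma entire_comp (f g : C -> C) : entire f -> entire g -> entire (fun z => f (g z)).
Proof.
move=> df dg z.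
apply/derivable1_diffP.
apply: (@differentiable_comp _ _ _ _ (g : C^o -> C^o) (f : C^o -> C^o)); apply/derivable1_diffP.
- exact: dg.
- exact: df.
Qed.

Lemma entire_id : entire (fun z : C => z).
Proof. move=> z; exact: derivable_id. Qed.

Lemma entire_cst (c : C) : entire (fun _ : C => c).
Proof. move=> z; exact: derivable_cst. Qed.

Lemma entireD (f g : C -> C) : entire f -> entire g -> entire (fun z => f z + g z).
Proof. by move=> df dg z; exact: (derivableD (df z) (dg z)). Qed.

Lemma entireX (f : C -> C) n : entire f -> entire (fun z => f z ^+ n).
Proof.
move=> df; elim: n => [|n IH]; first exact: entire_cst.
rewrite (_ : (fun z => f z ^+ n.+1) = (fun z => f z * f z ^+ n)); first exact: entireM.
by apply/funext => z; rewrite exprS.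
Qed.

End Differentiability.

(** * Power series *)

Section ComplexSeries.
Context {R : realType}.
Local Notation C := (R[i]).
Local Notation nc := (@Normc.normc R).
Implicit Types f g : nat -> C.

Definition csummable f : Prop := cvgn (series (fun k => nc (f k))).

(* [R[i]] has no completeness instance, hence the componentwise limits. *)
Definition csum f : C :=
  Complex (limn (series (fun k => complex.Re (f k))))
          (limn (series (fun k => complex.Im (f k)))).

Lemma csummable_le f (g : nat -> R) :
  (forall k, nc (f k) <= g k) -> cvgn (series g) -> csummable f.
Proof.
move=> fg; apply: (series_le_cvg _ _ fg) => k; first exact: nc_ge0.
exact: le_trans (nc_ge0 _) (fg k).
Qed.

Lemma csummable_Re f : csummable f -> cvgn (series (fun k => complex.Re (f k))).
Proof.
move=> sf; apply: normed_cvg.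
apply: (series_le_cvg _ _ _ sf) => k; first exact: normr_ge0.
  exact: nc_ge0.
exact: normr_Re_le.
Qed.

Lemma csummable_Im f : csummable f -> cvgn (series (fun k => complex.Im (f k))).
Proof.
move=> sf; apply: normed_cvg.
apply: (series_le_cvg _ _ _ sf) => k; first exact: normr_ge0.
  exact: nc_ge0.
exact: normr_Im_le.
Qed.

Lemma csummableD f g : csummable f -> csummable g -> csummable (fun k => f k + g k).
Proof.
move=> sf sg; apply: (@csummable_le _ (fun k => nc (f k) + nc (g k))).
  by move=> k; exact: ncD.
exact: is_cvg_seriesD.
Qed.

Lemma csummableZ (c : C) f : csummable f -> csummable (fun k => c * f k).
Proof.
move=> sf; apply: (@csummable_le _ (fun k => nc c * nc (f k))).
  by move=> k; rewrite Normc.normcM.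
exact: (@is_cvg_seriesZ R _ (nc c) sf).
Qed.

Lemma csumD f g : csummable f -> csummable g ->
  csum (fun k => f k + g k) = csum f + csum g.
Proof.
move=> sf sg; apply/eqP; rewrite eq_complex /=; apply/andP; split; apply/eqP.
- rewrite -(lim_seriesD (csummable_Re sf) (csummable_Re sg)).
  congr (limn (series _)); apply/funext => k.
  rewrite -[RHS]/(complex.Re (f k) + complex.Re (g k)).
  by case: (f k) (g k) => [? ?] [].
- rewrite -(lim_seriesD (csummable_Im sf) (csummable_Im sg)).
  congr (limn (series _)); apply/funext => k.
  rewrite -[RHS]/(complex.Im (f k) + complex.Im (g k)).
  by case: (f k) (g k) => [? ?] [].
Qed.

Lemma csumZ (c : C) f : csummable f -> csum (fun k => c * f k) = c * csum f.
Proof.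
move=> sf; case: c => a b.
have sR := csummable_Re sf; have sI := csummable_Im sf.
have ZR d := @is_cvg_seriesZ R _ d sR.
have ZI d := @is_cvg_seriesZ R _ d sI.
have LR d := @lim_seriesZ R _ d sR.
have LI d := @lim_seriesZ R _ d sI.
apply/eqP; rewrite eq_complex /=; apply/andP; split; apply/eqP.
- transitivity (limn (series ((a *: (fun k => complex.Re (f k)) : R^o ^nat) -
      (b *: (fun k => complex.Im (f k)) : R^o ^nat)))).
    congr (limn (series _)); apply/funext => k.
    rewrite -[RHS]/(a * complex.Re (f k) - b * complex.Im (f k)).
    by case: (f k).
  by rewrite (lim_seriesB (ZR a) (ZI b)) LR LI.
- transitivity (limn (series ((a *: (fun k => complex.Im (f k)) : R^o ^nat) +
      (b *: (fun k => complex.Re (f k)) : R^o ^nat)))).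
    congr (limn (series _)); apply/funext => k.
    rewrite -[RHS]/(a * complex.Im (f k) + b * complex.Re (f k)).
    by case: (f k).
  by rewrite (lim_seriesD (ZI a) (ZR b)) LR LI.
Qed.

Lemma limn_series_recl (u : nat -> R) : cvgn (series u) ->
  limn (series u) = u 0%N + limn (series (fun k => u k.+1)).
Proof.
move=> cu.
have E : series (fun k => u k.+1) = (fun n => series u n.+1 - u 0%N).
  by apply/funext => n; rewrite /series /= big_nat_recl// addrC addKr.
have cS : (fun n => series u n.+1 - u 0%N) @ \oo --> limn (series u) - u 0%N.
  apply: cvgB; last exact: cvg_cst.
  by rewrite (cvg_shiftS (series u)).
by rewrite E (cvg_lim _ cS)// addrC subrK.
Qed.

Lemma csum_recl f : csummable f -> csum f = f 0%N + csum (fun k => f k.+1).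
Proof.
move=> sf; apply/eqP; rewrite eq_complex /=.
rewrite (limn_series_recl (csummable_Re sf)) (limn_series_recl (csummable_Im sf)).
by case: (f 0%N) => a b /=; rewrite !eqxx.
Qed.

(** The factor 2 comes from estimating the real and imaginary sums separately. *)
Lemma nc_csum_le f (g : nat -> R) :
  (forall k, nc (f k) <= g k) -> cvgn (series g) ->
  nc (csum f) <= 2 * limn (series g).
Proof.
move=> fg cg; apply: (le_trans (nc_le_ReIm _)); rewrite mulr_natl mulr2n /=.
have aux (u : nat -> R) : (forall k, `|u k| <= g k) ->
    `|limn (series u)| <= limn (series g).
  move=> ug; have cu : cvgn [normed series u].
    apply: (series_le_cvg _ _ ug cg) => k; first exact: normr_ge0.
    exact: le_trans (normr_ge0 _) (ug k).
  by rewrite (le_trans (lim_series_norm cu))// lim_series_le.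
by apply: lerD; apply: aux => k; apply: le_trans (fg k);
  [exact: normr_Re_le|exact: normr_Im_le].
Qed.

End ComplexSeries.

Section PowerSeries.
Context {R : realType}.
Local Notation C := (R[i]).
Local Notation nc := (@Normc.normc R).
Variable a : nat -> C.
Hypothesis a_rapid : forall r : R, 0 <= r ->
  exists B : R, forall k, nc (a k) * r ^+ k <= B.

(** Boundedness at radius [2 * r] dominates the terms at radius [r] by a geometric series of ratio
    1/2. *)
Lemma rapid_cvg (r : R) : 0 <= r ->
  cvgn (series (fun k => nc (a k) * r ^+ k)).
Proof.
move=> r0; have [B HB] := a_rapid (mulr_ge0 (ler0n _ 2) r0).
apply: (@series_le_cvg _ _ (geometric B 2^-1)).
- by move=> k; rewrite mulr_ge0 ?nc_ge0 ?exprn_ge0.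
- move=> k; rewrite /= mulr_ge0 ?exprn_ge0 ?invr_ge0//.
  by rewrite (le_trans _ (HB 0%N))// expr0 mulr1 nc_ge0.
- move=> k /=; rewrite exprVn ler_pdivlMr ?exprn_gt0//.
  by rewrite -mulrA -exprMn [r * 2]mulrC.
- by apply: is_cvg_geometric_series; rewrite ger0_norm ?invr_ge0// invf_lt1 ?ltr1n.
Qed.

Lemma csummable_pseries (u : C) : csummable (fun k => a k * u ^+ k).
Proof.
apply: csummable_le (rapid_cvg (nc_ge0 u)) => k.
by rewrite Normc.normcM ncX.
Qed.

(** Induction on [k]: the remainder is multiplied by [u + h] and gains [k * u ^+ k.-1 * h ^+ 2]. The
    crude factor [4 ^+ k] absorbs the coefficient [k] and the sum of the two contributions. *)
Lemma expr_taylor1_bound (u h : C) (rho : R) (k : nat) :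
  1 <= rho -> nc u <= rho -> nc (u + h) <= rho ->
  nc ((u + h) ^+ k - u ^+ k - k%:R * h * u ^+ k.-1) <= (4 * rho) ^+ k * nc h ^+ 2.
Proof.
move=> rho1 u_rho uh_rho; have rho0 : 0 <= rho by rewrite (le_trans _ rho1).
elim: k => [|k IH].
  by rewrite !expr0 subrr sub0r !mul0r oppr0 Normc.normc0 mul1r exprn_ge0// nc_ge0.
set D := _ - _ in IH.
have -> : (u + h) ^+ k.+1 - u ^+ k.+1 - k.+1%:R * h * u ^+ k.+1.-1 =
    (u + h) * D + k%:R * u ^+ k.-1 * h ^+ 2.
  (* The predecessor truncates at 0, so the exponent [k.-1] calls for a case split. *)
  rewrite /D; case: k {IH D} => [|k] /=.
    by rewrite !expr0 !expr1; ring.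
  by rewrite !exprS -[k.+2]addn1 natrD; ring.
apply: (le_trans (ncD _ _)); rewrite !Normc.normcM !ncX nc_nat.
have h2 : 0 <= nc h ^+ 2 by rewrite exprn_ge0// nc_ge0.
have u_le : nc u ^+ k.-1 <= rho ^+ k.
  apply: (@le_trans _ _ (rho ^+ k.-1)); first by rewrite lerXn2r ?nnegrE ?nc_ge0.
  by rewrite ler_weXn2l// leq_pred.
have k4 : k%:R <= 4 ^+ k :> R by rewrite -natrX ler_nat ltnW// ltn_expl.
apply: (@le_trans _ _ (rho * ((4 * rho) ^+ k * nc h ^+ 2) +
    4 ^+ k * (rho * rho ^+ k) * nc h ^+ 2)).
  apply: lerD; first by rewrite ler_pM ?nc_ge0.
  rewrite ler_wpM2r// ler_pM ?exprn_ge0 ?nc_ge0//.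
  by rewrite (le_trans u_le)// ler_peMl// exprn_ge0.
have X0 : 0 <= rho * (4 * rho) ^+ k * nc h ^+ 2.
  by apply: mulr_ge0 => //; rewrite mulr_ge0// exprn_ge0// mulr_ge0.
rewrite (exprS (4 * rho)) (exprMn k 4 rho); move: X0; rewrite !exprMn.
set A := 4 ^+ k; set B := rho ^+ k; set H := nc h ^+ 2.
lra.
Qed.

(** Termwise differentiation: the second-order remainders of the monomials, weighted by the
    coefficients, add up to at most [M * nc h ^+ 2], where [M] comes from the majorant at radius
    [4 * rho]. *)
Lemma entire_pseries : entire (fun u => csum (fun k => a k * u ^+ k)).
Proof.
move=> u; pose rho := nc u + 1.
have rho1 : 1 <= rho by rewrite lerDr nc_ge0.
have rho0 : 0 <= rho by rewrite (le_trans _ rho1).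
pose g k := nc (a k) * (4 * rho) ^+ k.
have cg : cvgn (series g) by apply: rapid_cvg; rewrite mulr_ge0.
pose L := csum (fun k => a k * (k%:R * u ^+ k.-1)).
have sL : csummable (fun k => a k * (k%:R * u ^+ k.-1)).
  apply: csummable_le cg => k; rewrite /g !Normc.normcM nc_nat ncX.
  rewrite ler_wpM2l ?nc_ge0// exprMn ler_pM ?exprn_ge0 ?nc_ge0//.
    by rewrite -natrX ler_nat ltnW// ltn_expl.
  apply: (@le_trans _ _ (rho ^+ k.-1)); last by rewrite ler_weXn2l// leq_pred.
  by rewrite lerXn2r ?nnegrE ?nc_ge0// lerDl.
apply: (@has_cderiv_derivable _ _ _ L) => e e0.
pose M := 2 * limn (series g).
have M0 : 0 <= M.
  apply: (le_trans (nc_ge0 (csum a))); apply: nc_csum_le cg => k.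
  by rewrite /g ler_peMr ?nc_ge0// exprn_ege1//; lra.
(* The bound 1 keeps [u + h] in the disc of radius [rho]; dividing by [M + 1] covers the case where
   [M] is 0. *)
exists (Num.min 1 (e / (M + 1))); first by rewrite lt_min ltr01 divr_gt0// ltr_wpDl.
move=> h; rewrite lt_min => /andP[h1 he].
pose D k := a k * ((u + h) ^+ k - u ^+ k - k%:R * h * u ^+ k.-1).
have -> : csum (fun k => a k * (u + h) ^+ k) - csum (fun k => a k * u ^+ k) - L * h = csum D.
  have sA := @csummable_pseries (u + h).
  have sB := @csummable_pseries u.
  have sNB := @csummableZ _ (-1) _ sB; have sNL := @csummableZ _ (- h) _ sL.
  have -> : forall x y : C, x - y - L * h = x + -1 * y + - h * L by move=> *; ring.
  rewrite /L -(csumZ _ sB) -(csumZ _ sL) -csumD// -csumD//; last exact: csummableD.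
  by congr csum; apply/funext => k; rewrite /D; ring.
have DM : nc (csum D) <= M * nc h ^+ 2.
  have cgh := @is_cvg_seriesZ R g (nc h ^+ 2) cg.
  have E : limn (series (nc h ^+ 2 *: g)) = nc h ^+ 2 * limn (series g).
    exact: (@lim_seriesZ R g (nc h ^+ 2) cg).
  rewrite /M -mulrA [_ * nc h ^+ 2]mulrC -E.
  apply: nc_csum_le cgh => k; rewrite /D Normc.normcM.
  rewrite -[leRHS]/(nc h ^+ 2 * (nc (a k) * (4 * rho) ^+ k)) mulrCA.
  rewrite ler_wpM2l ?nc_ge0// [leRHS]mulrC expr_taylor1_bound// /rho ?lerDl//.
  by rewrite (le_trans (ncD _ _))// lerD2l ltW.
apply: (le_trans DM); rewrite expr2 mulrA ler_wpM2r ?nc_ge0//.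
have : M * nc h <= M * (e / (M + 1)) by rewrite ler_wpM2l// ltW.
move/le_trans; apply; rewrite mulrA ler_pdivrMr ?ltr_wpDl// mulrC ler_wpM2l ?ltW//; lra.
Qed.

End PowerSeries.

(** * The Jacobi product *)

Section EulerFunction.
Context {R : realType}.
Local Notation C := (R[i]).
Local Notation nc := (@Normc.normc R).
Variable q : C.
Hypothesis q_lt1 : nc q < 1.

(* Coefficients of the product of the [1 - q ^+ m * u] over [m >= 0]. *)
Fixpoint euler_coef (k : nat) : C :=
  if k is j.+1 then - (q ^+ j / (1 - q ^+ j.+1)) * euler_coef j else 1.

Lemma nc_1BqX_ge k : 1 - nc q <= nc (1 - q ^+ k.+1).
Proof.
have := ncD (1 - q ^+ k.+1) (q ^+ k.+1); rewrite subrK Normc.normc1 ncX.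
have : nc q ^+ k.+1 <= nc q.
  by rewrite exprS ler_piMr ?nc_ge0// exprn_ile1 ?nc_ge0// ltW.
lra.
Qed.

(** Ratio test: consecutive terms have ratio at most [nc q ^+ k * r / (1 - nc q)], which tends to 0.
    The terms are therefore nonincreasing from some [N] on, and the sum of the terms up to [N]
    bounds them all. *)
Lemma euler_coef_rapid (r : R) : 0 <= r ->
  exists B : R, forall k, nc (euler_coef k) * r ^+ k <= B.
Proof.
move=> r0; pose b k := nc (euler_coef k) * r ^+ k.
have b0 k : 0 <= b k by rewrite mulr_ge0 ?nc_ge0 ?exprn_ge0.
have q1 : 0 < 1 - nc q by rewrite subr_gt0.
have bS k : b k.+1 <= nc q ^+ k * r / (1 - nc q) * b k.
  rewrite /b /= Normc.normcM ncN Normc.normcM Normc.normcV ncX (exprSr r).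
  have -> : forall x y z t u : R, x * y * z * (t * u) = (x * u * y) * (z * t) by move=> *; ring.
  apply: ler_wpM2r; first by rewrite mulr_ge0 ?nc_ge0 ?exprn_ge0.
  apply: ler_wpM2l; first by rewrite mulr_ge0 ?exprn_ge0 ?nc_ge0.
  by rewrite lef_pV2 ?posrE ?nc_1BqX_ge// (lt_le_trans q1)// nc_1BqX_ge.
have [N HN] : exists N, forall k, (N <= k)%N -> nc q ^+ k * r <= 1 - nc q.
  have cq : (fun n => nc q ^+ n) @ \oo --> (0 : R).
    by apply: cvg_expr; rewrite ger0_norm ?nc_ge0.
  have e0 : 0 < (1 - nc q) / (r + 1) by rewrite divr_gt0// ltr_wpDl.
  move/cvgrPdist_le: cq => /(_ _ e0)[N _ HN].
  exists N => k /HN; rewrite sub0r normrN ger0_norm ?exprn_ge0 ?nc_ge0// => H.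
  apply: (le_trans (ler_wpM2r r0 H)).
  by rewrite mulrAC ler_pdivrMr ?ltr_wpDl// ler_wpM2l ?(ltW q1)// lerDl.
have bdec k : (N <= k)%N -> b k.+1 <= b k.
  move=> Nk; apply: (le_trans (bS k)); rewrite ler_piMl//.
  by rewrite ler_pdivrMr// mul1r HN.
exists (\sum_(j < N.+1) b j) => k; rewrite -/(b k).
have [kN|Nk] := leqP k N.
  rewrite -ltnS in kN; rewrite (bigD1 (Ordinal kN))//= lerDl.
  exact: sumr_ge0.
rewrite -(subnKC (ltnW Nk)); elim: (k - N)%N => [|j IH].
  by rewrite addn0 big_ord_recr /= lerDr sumr_ge0.
by rewrite addnS (le_trans _ IH)// bdec// leq_addr.
Qed.

Definition euler (u : C) : C := csum (fun k => euler_coef k * u ^+ k).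

Lemma entire_euler : entire euler.
Proof. exact: entire_pseries euler_coef_rapid. Qed.

(** Coefficient by coefficient, this is the recursion c_(k+1) (1 - q^(k+1)) = - q^k c_k that defines
    [euler_coef]. It stands in for splitting off the first factor of the infinite product. *)
Lemma eulerE u : euler u = (1 - u) * euler (q * u).
Proof.
have sum v := @csummable_pseries _ _ euler_coef_rapid v.
have sS v : csummable (fun k => euler_coef k.+1 * v ^+ k.+1).
  rewrite /csummable; have := sum v; rewrite /csummable => s.
  have -> : series (fun k => nc (euler_coef k.+1 * v ^+ k.+1)) =
      (fun n => series (fun k => nc (euler_coef k * v ^+ k)) n.+1 - nc (euler_coef 0 * v ^+ 0)).
    by apply/funext => n; rewrite /series /= big_nat_recl// addrC addKr.
  apply: is_cvgB; last exact: is_cvg_cst.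
  by apply: cvgP; rewrite (cvg_shiftS (series (fun k => nc (euler_coef k * v ^+ k)))); exact: s.
rewrite mulrBl mul1r /euler -(csumZ u (sum _)).
rewrite (csum_recl (sum u)) (csum_recl (sum (q * u))) !expr0 -addrA.
congr (_ + _); rewrite -[- csum _]mulN1r -csumZ; last by apply: csummableZ; exact: sum.
rewrite -csumD; [|exact: sS|by do 2 apply: csummableZ; exact: sum].
congr csum; apply/funext => k /=.
have d0 : 1 - q ^+ k.+1 != 0.
  by rewrite -nc_gt0 (lt_le_trans _ (nc_1BqX_ge k))// subr_gt0.
move: d0; rewrite exprMn exprMn !exprS => d0; field; exact: d0.
Qed.

Lemma euler0 : euler 0 = 1.
Proof.
have sum := @csummable_pseries _ _ euler_coef_rapid 0.
rewrite /euler (csum_recl sum) expr0 mulr1 /=.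
rewrite (_ : (fun k => _) = (fun k => 0 * (euler_coef k * 0 ^+ k))).
  by rewrite csumZ// mul0r addr0.
by apply/funext => k; rewrite (exprS 0) !mul0r mulr0.
Qed.

(** If no factor vanishes, the functional equation carries the zero at [u] to every [q ^+ m * u].
    These points tend to 0, against continuity there and [euler 0 = 1]. *)
Lemma euler_eq0 u : euler u = 0 -> exists m, q ^+ m * u = 1.
Proof.
move=> Eu; apply: contrapT => nm.
have E0 m : euler (q ^+ m * u) = 0.
  elim: m => [|m IH]; first by rewrite expr0 mul1r.
  have : (1 - q ^+ m * u) * euler (q * (q ^+ m * u)) = 0 by rewrite -eulerE.
  move/eqP; rewrite mulf_eq0 subr_eq0 => /orP[/eqP e1|/eqP].
    by case: nm; exists m.
  by rewrite mulrA -exprS.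
have /derivable1_diffP/differentiable_continuous cE := @entire_euler 0.
have /cvgrPdist_lt /(_ 1 ltr01) /nbhs_ballP[d /= d0 Hd] := cE.
have dR : d = (complex.Re d)%:C%C by rewrite RRe_real// gtr0_real.
have d'0 : 0 < complex.Re d by rewrite -ltcR -dR.
have cq : (fun n => nc q ^+ n) @ \oo --> (0 : R).
  by apply: cvg_expr; rewrite ger0_norm ?nc_ge0.
have e0 : 0 < complex.Re d / (nc u + 1) by rewrite divr_gt0// ltr_wpDl// nc_ge0.
move/cvgrPdist_lt: cq => /(_ _ e0)[N _ HN].
have := HN N (leqnn N); rewrite sub0r normrN ger0_norm ?exprn_ge0 ?nc_ge0// => qN.
have qNd : `|q ^+ N * u| < d.
  rewrite dR ncE ltcR Normc.normcM ncX.
  move: qN; rewrite ltr_pdivlMr ?ltr_wpDl ?nc_ge0//; apply: le_lt_trans.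
  by rewrite ler_wpM2l ?exprn_ge0 ?nc_ge0// lerDl.
have := Hd (q ^+ N * u); rewrite /ball /= sub0r normrN => /(_ qNd).
by rewrite euler0 E0 subr0 normr1 ltxx.
Qed.

End EulerFunction.

(** * Lattices and the signed area of a basis *)

Section Lattice.
Context {R : realType}.
Local Notation C := (R[i]).
Implicit Types x y z : C.

Lemma latticeC (w1 w2 : C) : lattice w1 w2 = lattice w2 w1.
Proof.
by apply/seteqP; split => x [m [n ->]]; exists n, m; rewrite addrC.
Qed.

Lemma lattice0 (w1 w2 : C) : lattice w1 w2 0.
Proof. by exists 0, 0; rewrite !mulr0z addr0. Qed.

Lemma latticeD (w1 w2 : C) x y : lattice w1 w2 x -> lattice w1 w2 y -> lattice w1 w2 (x + y).
Proof.
move=> [m [n ->]] [m' [n' ->]]; exists (m + m'), (n + n').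
by rewrite !mulrzDr addrACA.
Qed.

Lemma latticeN (w1 w2 : C) x : lattice w1 w2 x -> lattice w1 w2 (- x).
Proof. by move=> [m [n ->]]; exists (- m), (- n); rewrite !mulrNz opprD. Qed.

Lemma latticeB (w1 w2 : C) x y : lattice w1 w2 x -> lattice w1 w2 y -> lattice w1 w2 (x - y).
Proof. by move=> Hx Hy; apply: latticeD => //; exact: latticeN. Qed.

Lemma lattice_gen1 (w1 w2 : C) : lattice w1 w2 w1.
Proof. by exists 1, 0; rewrite mulr1z mulr0z addr0. Qed.

Lemma lattice_gen2 (w1 w2 : C) : lattice w1 w2 w2.
Proof. by rewrite latticeC; exact: lattice_gen1. Qed.

Lemma intr_real (m : int) : (m%:~R : R)%:C%C = m%:~R :> C.
Proof. exact: rmorph_int. Qed.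

Lemma R_independentC (w1 w2 : C) : R_independent w1 w2 -> R_independent w2 w1.
Proof. by move=> H a b; rewrite addrC => /H []. Qed.

Lemma R_independent_neq0 (w1 w2 : C) : R_independent w1 w2 -> w1 != 0.
Proof.
move=> H; apply/eqP => w0.
have [] := H 1 0; first by rewrite w0 mulr0 mul0r addr0.
by move=> /eqP; rewrite oner_eq0.
Qed.

(** The determinant of the basis; for nonzero [w1] it is positive exactly when [w2 / w1] lies in the
    upper half-plane. *)
Definition oriented_area (w1 w2 : C) : R := complex.Im (conjc w1 * w2).

Lemma oriented_areaC (w1 w2 : C) : oriented_area w2 w1 = - oriented_area w1 w2.
Proof. by case: w1 w2 => [a b] [c d]; rewrite /oriented_area /=; ring. Qed.

(** If the determinant of a + ib and c + id is 0, then (c, -a) and (d, -b) are coefficients of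
    linear relations; independence makes them vanish, so [w1] is 0. *)
Lemma oriented_area_neq0 (w1 w2 : C) : R_independent w1 w2 -> oriented_area w1 w2 != 0.
Proof.
move=> H; apply/eqP; rewrite /oriented_area.
have := R_independent_neq0 H; case: w1 w2 H => [a b] [c d] H w0 /= A0.
have [|a0 b0] := H c (- a).
  by apply/eqP; rewrite eq_complex /=; apply/andP; split; apply/eqP; move: A0; lra.
have [|a1 b1] := H d (- b).
  by apply/eqP; rewrite eq_complex /=; apply/andP; split; apply/eqP; move: A0; lra.
by move: w0; rewrite eq_complex /= -[a]opprK -[b]opprK b0 b1 oppr0 eqxx.
Qed.

(** The source of points off the lattice: by uniqueness of coordinates [r] would be an integer
    strictly between 0 and 1. *)
Lemma lattice_scal (w1 w2 : C) (r : R) : R_independent w1 w2 -> 0 < r < 1 ->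
  ~ lattice w1 w2 (r%:C%C * w1).
Proof.
move=> H /andP[r0 r1] [m [n E]].
have [] := H (r - m%:~R) (- n%:~R).
  rewrite rmorphB rmorphN /= !intr_real mulrBl mulNr E -[w1 *~ m]mulrzl -[w2 *~ n]mulrzl; ring.
move=> /eqP; rewrite subr_eq0 => /eqP rm _.
by move: r0 r1; rewrite rm ltr0z ltrz1 gtz0_ge1 => m1; rewrite ltNge m1.
Qed.

End Lattice.

(** * The Jacobi product of an oriented basis: quasi-periodicity and zeros *)

Section Sigma.
Context {R : realType}.
Local Notation C := (R[i]).
Local Notation nc := (@Normc.normc R).
Variables w1 w2 : C.
Hypothesis w_indep : R_independent w1 w2.
Hypothesis w_oriented : 0 < oriented_area w1 w2.

Let w1_neq0 : w1 != 0. Proof. exact: R_independent_neq0 w_indep. Qed.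

(** Chosen so that [cexp (freq * z)] has period [w1]. *)
Definition freq : C := Complex 0 (2 * pi) / w1.

Lemma freq_gen1 : freq * w1 = Complex 0 (2 * pi).
Proof. by rewrite /freq divfK. Qed.

Lemma freq_neq0 : freq != 0.
Proof.
rewrite mulf_neq0 ?invr_eq0// eq_complex /= negb_and; apply/orP; right.
by rewrite gt_eqF// mulr_gt0// pi_gt0.
Qed.

Definition nome : C := cexp (freq * w2).

(** With tau = w2 / w1, [nome] is exp (2 pi i tau), and the imaginary part of tau is the oriented
    area divided by [nc w1 ^+ 2]. *)
Lemma nome_lt1 : nc nome < 1.
Proof.
rewrite nc_cexp expR_lt1 /freq -mulrA [_^-1 * _]mulrC.
have -> : w2 / w1 = (conjc w1 * w2) / ((nc w1 ^+ 2)%:C)%C.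
  have N : (nc w1 ^+ 2)%:C%C = w1 * conjc w1 by rewrite rmorphXn /= -sqr_normc.
  have cw : conjc w1 != 0 by rewrite conjc_eq0.
  by rewrite N; field; rewrite w1_neq0 andbT; exact: cw.
have n0 : 0 < nc w1 ^+ 2 by rewrite exprn_gt0// nc_gt0.
rewrite -(fmorphV (real_complex R)); move: w_oriented; rewrite /oriented_area.
set u := conjc w1 * w2; case: u => a b /= b0.
rewrite mul0r sub0r oppr_lt0 mulr0 add0r.
by rewrite !mulr_gt0// ?pi_gt0// invr_gt0.
Qed.

(* With [u = cexp (freq * z)], the product of the [1 - nome ^+ m * u] over
   [m >= 0] and of the [1 - nome ^+ m / u] over [m >= 1]. *)
Definition sigma (z : C) : C :=
  euler nome (cexp (freq * z)) * euler nome (cexp (freq * (w2 - z))).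

Lemma entire_sigma : entire sigma.
Proof.
have eE := entire_euler nome_lt1.
have ecst := @entire_cst R; have eid := @entire_id R.
have eL : entire (fun z : C => freq * z) := entireM (ecst freq) eid.
have eR : entire (fun z : C => freq * (w2 + -1 * z)) :=
  entireM (ecst freq) (entireD (ecst w2) (entireM (ecst (-1)) eid)).
have -> : sigma = (fun z => euler nome (cexp (freq * z)) *
    euler nome (cexp (freq * (w2 + -1 * z)))).
  by apply/funext => z; rewrite /sigma mulN1r.
exact: (entireM (entire_comp eE (entire_comp entire_cexp eL))
                (entire_comp eE (entire_comp entire_cexp eR))).
Qed.

Lemma cexp_freq_gen1 (m : int) : cexp (freq * w1 * m%:~R) = 1.
Proof.
rewrite freq_gen1 -[RHS](cexp_2pi_int m) -intr_real; congr cexp.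
by apply/eqP; rewrite eq_complex /=; apply/andP; split; apply/eqP; ring.
Qed.

Lemma sigma_gen1 z : sigma (z + w1) = sigma z.
Proof.
have e1 : cexp (freq * (z + w1)) = cexp (freq * z).
  by rewrite mulrDr cexpD -[freq * w1]mulr1 (cexp_freq_gen1 1) mulr1.
have e2 : cexp (freq * (w2 - (z + w1))) = cexp (freq * (w2 - z)).
  have -> : freq * (w2 - (z + w1)) = freq * (w2 - z) + freq * w1 * (-1)%:~R.
    by rewrite rmorphN1; ring.
  by rewrite cexpD cexp_freq_gen1 mulr1.
by rewrite /sigma e1 e2.
Qed.

(** The shift replaces u = cexp (freq * z) by nome * u: the first product loses the factor 1 - u,
    the second gains 1 - 1/u, and 1 - 1/u = - (1/u) (1 - u). *)
Lemma sigma_gen2 z : sigma (z + w2) = - cexp (- (freq * z)) * sigma z.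
Proof.
have e1 : nome * cexp (freq * z) = cexp (freq * (z + w2)).
  by rewrite /nome -cexpD -mulrDr [w2 + z]addrC.
have e2 : nome * cexp (- (freq * z)) = cexp (freq * (w2 - z)).
  by rewrite /nome -cexpD -mulrN -mulrDr.
have e3 : freq * (w2 - (z + w2)) = - (freq * z) by ring.
have := eulerE nome_lt1 (cexp (freq * z)).
have := eulerE nome_lt1 (cexp (- (freq * z))).
rewrite /sigma e3 e1 e2 => -> ->.
have := cexp_neq0 (freq * z); rewrite cexpN.
move: (cexp (freq * z)) (euler _ _) (euler _ _) => u A B u0.
by field.
Qed.

(** A vanishing factor puts [freq * (x + m * w2)] among the integer multiples of 2 pi i =
    [freq * w1], for [x] equal to [z] or to [w2 - z]. *)
Lemma sigma_eq0 z : sigma z = 0 -> lattice w1 w2 z.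
Proof.
have aux x m : nome ^+ m * cexp (freq * x) = 1 -> lattice w1 w2 x.
  rewrite /nome -cexpMn -cexpD => /cexp_eq1[k Ek].
  exists k, (- Posz m); apply: (mulfI freq_neq0).
  have E1 : freq * (w1 *~ k) = Complex 0 (2 * pi * k%:~R).
    rewrite mulrzAr freq_gen1 -mulrzr -intr_real.
    by apply/eqP; rewrite eq_complex /=; apply/andP; split; apply/eqP; ring.
  have E2 : freq * (w2 *~ - Posz m) = - (freq * w2 *+ m).
    by rewrite mulrNz mulrN mulrzAr pmulrn.
  by rewrite mulrDr E1 E2 -Ek addrC addKr.
move/eqP; rewrite mulf_eq0 => /orP[] /eqP /(euler_eq0 nome_lt1) [m] /aux //.
move=> /(latticeB (lattice_gen2 w1 w2)).
by rewrite opprB addrC subrK.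
Qed.

End Sigma.

(** * Theta functions *)

Section ThetaFunctions.
Context {R : realType}.
Local Notation C := (R[i]).
Implicit Types x y z : C.

Variables (nu : R) (w1 w2 : C) (chi : C -> C).
Local Notation Gamma := (lattice w1 w2).
Hypothesis nu_gt0 : 0 < nu.
Hypothesis w_indep : R_independent w1 w2.
Hypothesis chiP : pseudo_character nu Gamma chi.

Definition multiplier (gamma z : C) : C :=
  chi gamma * cexp (nu%:C%C * (z + gamma / 2) * conjc gamma).

Lemma chi_neq0 gamma : Gamma gamma -> chi gamma != 0.
Proof. by case: chiP => chi1 _ /chi1; rewrite -normr_gt0 => ->; rewrite ltr01. Qed.

Lemma multiplier_neq0 gamma z : Gamma gamma -> multiplier gamma z != 0.
Proof. by move=> G; rewrite mulf_neq0 ?chi_neq0 ?cexp_neq0. Qed.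

Lemma chi0 : chi 0 = 1.
Proof.
have G0 := lattice0 w1 w2.
apply: (mulfI (chi_neq0 G0)); rewrite mulr1.
have := chiP.2 _ _ G0 G0.
by rewrite addr0 mul0r conjc0 mulr0 subrr mulr0 cexp0 mulr1 => <-.
Qed.

(** The cocycle relation: the defect of [chi] from being a character is exactly what the
    exponentials leave over. *)
Lemma multiplierD gamma gamma' z : Gamma gamma -> Gamma gamma' ->
  multiplier (gamma + gamma') z = multiplier gamma' (z + gamma) * multiplier gamma z.
Proof.
move=> G G'; rewrite /multiplier chiP.2//.
rewrite -mulrA -cexpD [RHS]mulrACA -cexpD [chi gamma' * _]mulrC; congr (_ * cexp _).
by rewrite rmorphD /=; field.
Qed.

Lemma multiplier0 z : multiplier 0 z = 1.
Proof. by rewrite /multiplier chi0 conjc0 mulr0 cexp0 mulr1. Qed.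

(** By the cocycle relation, the lattice vectors for which [f] obeys the law form a subgroup, here
    containing both generators. *)
Lemma quasiperiodic_lattice (f : C -> C) :
  (forall z, f (z + w1) = multiplier w1 z * f z) ->
  (forall z, f (z + w2) = multiplier w2 z * f z) ->
  forall z gamma, Gamma gamma -> f (z + gamma) = multiplier gamma z * f z.
Proof.
move=> f1 f2.
pose P gamma := Gamma gamma /\ forall z, f (z + gamma) = multiplier gamma z * f z.
have PD x y : P x -> P y -> P (x + y).
  move=> [Gx fx] [Gy fy]; split=> [|z]; first exact: latticeD.
  by rewrite addrA fy fx multiplierD// mulrA.
have P0 : P 0.
  by split=> [|z]; [exact: lattice0|rewrite addr0 multiplier0 mul1r].
have PN x : P x -> P (- x).
  move=> [Gx fx]; have GNx := latticeN Gx; split=> // z.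
  apply: (mulfI (multiplier_neq0 (z - x) Gx)).
  by rewrite -fx subrK mulrA -multiplierD// addrC subrr multiplier0 mul1r.
have PZ x (m : int) : P x -> P (x *~ m).
  move=> Px; have Pn n : P (x *+ n).
    by elim: n => [|n IH]; [rewrite mulr0n|rewrite mulrS; exact: PD].
  by case: (intP m) => [|n|n]; rewrite ?mulrNz; [exact: Pn 0%N| |apply: PN]; exact: Pn.
have P1 : P w1 by split=> //; exact: lattice_gen1.
have P2 : P w2 by split=> //; exact: lattice_gen2.
by move=> z gamma [m [n ->]]; have [] := PD _ _ (PZ w1 m P1) (PZ w2 n P2).
Qed.

Lemma oriented_areaE : nu%:C%C * (conjc w1 * w2 - w1 * conjc w2) =
  Complex 0 (2 * (nu * oriented_area w1 w2)).
Proof.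
rewrite /oriented_area; case: (w1) (w2) => [a b] [c d].
by apply/eqP; rewrite eq_complex /=; apply/andP; split; apply/eqP; ring.
Qed.

(* Comparing [chi (w1 + w2)] with [chi (w2 + w1)]. *)
Lemma area_quantized : exists k : int, nu * oriented_area w1 w2 = pi * k%:~R.
Proof.
have [G1 G2] := (lattice_gen1 w1 w2, lattice_gen2 w1 w2).
have E1 := chiP.2 _ _ G1 G2; have E2 := chiP.2 _ _ G2 G1.
move: E1; rewrite addrC E2 (mulrC (chi w2)).
move/(mulfI (mulf_neq0 (chi_neq0 G1) (chi_neq0 G2))) => E.
have {E} : cexp (nu%:C%C * (conjc w1 * w2 - w1 * conjc w2)) = 1.
  have -> : nu%:C%C * (conjc w1 * w2 - w1 * conjc w2) =
     nu%:C%C / 2 * (w2 * conjc w1 - conjc w2 * w1) -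
     nu%:C%C / 2 * (w1 * conjc w2 - conjc w1 * w2) by field.
  by rewrite cexpD E cexpN divff// cexp_neq0.
rewrite oriented_areaE.
move/cexp_eq1 => [k [E]]; exists k; lra.
Qed.

Hypothesis w_oriented : 0 < oriented_area w1 w2.

Let w1_neq0 : w1 != 0. Proof. exact: R_independent_neq0 w_indep. Qed.

Lemma area_quantized_pos : exists N : nat, nu * oriented_area w1 w2 = pi * N.+1%:R.
Proof.
have [k Ek] := area_quantized.
have : 0 < pi * k%:~R :> R by rewrite -Ek mulr_gt0.
rewrite pmulr_rgt0 ?pi_gt0// ltr0z => k0.
by case: k Ek k0 => // -[|N] // Ek _; exists N.
Qed.

(** One zero is adjusted and the remaining [N] are placed at [t], keeping the sum of all zeros equal
    to [s]. For [N = 0] there is no factor at [t], hence the condition [0 < N]. *)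
Lemma theta_product_exists : exists (N : nat) (s : C), forall t : C,
  exists2 f, theta_space nu Gamma chi f &
    forall z, f z = 0 -> Gamma (z - (s - N%:R * t)) \/ (0 < N)%N /\ Gamma (z - t).
Proof.
have [N HN] := area_quantized_pos; exists N.
pose c := freq w1.
(* [alpha] and [beta] are forced by the [w1]-multiplier, [s] by the constant
   factor of the [w2]-multiplier; the part of the latter that depends on [z] is
   the quantization of the area. *)
pose alpha := nu%:C%C * conjc w1 / (2 * w1).
have [b Hb] := cexp_surj (chi_neq0 (lattice_gen1 w1 w2)).
pose beta := b / w1.
have [v Hv] : exists v, cexp v = chi w2 * cexp (nu%:C%C * w2 * conjc w2 / 2) *
    cexp (- (alpha * w2 ^+ 2 + beta * w2)) * (-1) ^+ N.+1.
  apply: cexp_surj; rewrite mulf_neq0 ?expf_neq0 ?oppr_eq0 ?oner_eq0//.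
  by rewrite !mulf_neq0 ?cexp_neq0 ?chi_neq0//; exact: lattice_gen2.
pose s := v / c; exists s => t; pose a0 := s - N%:R * t.
have c0 : c != 0 := freq_neq0 w_indep.
have cs : c * s = v by rewrite mulrC divfK.
pose sg := sigma w1 w2.
pose f z := cexp (alpha * z ^+ 2 + beta * z) * (sg (z - a0) * sg (z - t) ^+ N).
have sg1 z x : sg (z + w1 - x) = sg (z - x).
  by rewrite addrAC; exact: (sigma_gen1 w_indep).
have sg2 z x : sg (z + w2 - x) = - cexp (- (c * (z - x))) * sg (z - x).
  by rewrite addrAC; exact: (sigma_gen2 w_indep w_oriented).
exists f.
  split.
    have eid := @entire_id R; have ecst := @entire_cst R.
    have eB x : entire (fun z : C => z - x) := entireD eid (ecst (- x)).
    have esg := entire_sigma w_indep w_oriented.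
    have esB x : entire (fun z => sg (z - x)) := entire_comp esg (eB x).
    have e1 : entire (fun z => alpha * z ^+ 2 + beta * z) :=
      entireD (entireM (ecst alpha) (@entireX R _ 2 eid)) (entireM (ecst beta) eid).
    have e2 : entire (fun z => sg (z - a0) * sg (z - t) ^+ N) :=
      entireM (esB a0) (@entireX R _ N (esB t)).
    exact: (entireM (entire_comp entire_cexp e1) e2).
  apply: quasiperiodic_lattice => z.
    rewrite /f !sg1 [RHS]mulrA; congr (_ * _).
    rewrite /multiplier -Hb -!cexpD; congr cexp.
    by rewrite /alpha /beta; field; rewrite w1_neq0.
  (* The choice of [v] eliminates [chi w2]; the sign anticipates the minus signs of the [N.+1] sigma
     factors. *)
  have mult2 : multiplier w2 z = (-1) ^+ N.+1 *
      cexp (alpha * w2 ^+ 2 + beta * w2 + c * s + nu%:C%C * z * conjc w2).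
    set A := _ + beta * w2.
    rewrite (cexpD (A + c * s)) (cexpD A) cs Hv cexpN /multiplier -/A.
    have -> : nu%:C%C * (z + w2 / 2) * conjc w2 =
        nu%:C%C * w2 * conjc w2 / 2 + nu%:C%C * z * conjc w2 by field.
    rewrite (cexpD (nu%:C%C * w2 * conjc w2 / 2)).
    have := cexp_neq0 A.
    have : (-1) ^+ N.+1 * (-1) ^+ N.+1 = 1 :> C by rewrite -expr2 sqrr_sign.
    move: ((-1) ^+ N.+1) (cexp A) (cexp (_ / 2)) (cexp _) (chi w2) => S a b1 b2 x SS a0'.
    by rewrite -[LHS]mul1r -SS; field; exact: a0'.
  (* Equality of the coefficients of [z] in the two exponents; it forces exactly [N.+1] sigma
     factors. *)
  have E1 : nu%:C%C * conjc w2 = 2 * alpha * w2 - N.+1%:R * c.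
    have : nu%:C%C * (conjc w1 * w2 - w1 * conjc w2) = N.+1%:R * (c * w1).
      rewrite oriented_areaE HN /c (freq_gen1 w_indep) -(rmorph_nat (real_complex R)).
      by apply/eqP; rewrite eq_complex /=; apply/andP; split; apply/eqP; ring.
    rewrite /alpha; move: (c) (N.+1%:R : C) w1_neq0 => c' n w10 E.
    apply: (mulfI w10).
    have -> : w1 * (2 * (nu%:C%C * conjc w1 / (2 * w1)) * w2 - n * c') =
       nu%:C%C * conjc w1 * w2 - n * (c' * w1) by field.
    by rewrite -E; ring.
  (* Here [t] drops out, because [a0 + N%:R * t = s]. *)
  have expo : alpha * (z + w2) ^+ 2 + beta * (z + w2) + - (c * (z - a0)) + - (c * (z - t)) *+ N =
      alpha * w2 ^+ 2 + beta * w2 + c * s + nu%:C%C * z * conjc w2 + (alpha * z ^+ 2 + beta * z).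
    rewrite [nu%:C%C * z * _]mulrAC E1 /a0 -[- _ *+ N]mulr_natr -(natr1 N).
    by move: (alpha) (beta) (c) (s) (N%:R : C) => al be c1 s1 n; ring.
  rewrite /f !sg2 mult2; move: (sg (z - a0)) (sg (z - t)) => y1 y2.
  rewrite !exprMn [(- cexp _) ^+ N]exprNn -cexpMn (exprS (-1) N) mulN1r.
  move: expo; set p1 := _ + _ * (z + w2); set p2 := - (c * (z - a0)); set p3 := _ *+ N.
  set p4 := _ + nu%:C%C * z * _; set p5 := _ + beta * z => expo.
  have : cexp p1 * cexp p2 * cexp p3 = cexp p4 * cexp p5 by rewrite -!cexpD expo.
  move: (cexp p1) (cexp p2) (cexp p3) (cexp p4) (cexp p5) ((-1) ^+ N) => e1 e2 e3 e4 e5 S E.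
  transitivity (- S * (e1 * e2 * e3) * (y1 * y2 ^+ N)); first by ring.
  by rewrite E; ring.
move=> z /eqP; rewrite mulf_eq0 (negbTE (cexp_neq0 _)) /= mulf_eq0 expf_eq0.
move=> /orP[/eqP|/andP[N0 /eqP]] /(sigma_eq0 w_indep w_oriented); [by left|by right; split].
Qed.

(** Take the product with t = z - x. It can vanish at [z] only if [x] or [z - (s - N%:R * t)] is in
    the lattice, so it suffices that [x] avoids both. *)
Lemma theta_nonvanishing_oriented : exists s : C, forall z, ~ Gamma (z - s) ->
  exists2 f, theta_space nu Gamma chi f & f z != 0.
Proof.
have [N [s H]] := theta_product_exists; exists s => z zs.
have [x [xG xs]] : exists x, ~ Gamma x /\ ~ Gamma (z - (s - N%:R * (z - x))).
  case: N {H} => [|N].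
    (* With a single factor the second condition is the assumption on [z], so half a period will
       do. *)
    exists ((1 / 2 : R)%:C%C * w1); rewrite mul0r subr0; split => //.
    by apply: lattice_scal => //; lra.
  have N0 : (0 : R) < N.+1%:R by rewrite ltr0n.
  have N1 : (1 : R) <= N.+1%:R by rewrite ler1n.
  (* If [x 1] and [x 2] both failed the second condition, the difference of their [N.+1]-fold
     multiples, a third of [w1], would be in the lattice. *)
  pose x (k : R) := (k / 3 / N.+1%:R)%:C%C * w1.
  have xG k : 0 < k -> k < 3 -> ~ Gamma (x k).
    move=> k0 k3; apply: lattice_scal => //; rewrite !divr_gt0//=.
    by rewrite ltr_pdivrMr// mul1r (lt_le_trans _ N1)// ltr_pdivrMr// mul1r.
  have Nx k : N.+1%:R * x k = (k / 3)%:C%C * w1.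
    rewrite /x mulrA; congr (_ * _).
    rewrite -(rmorph_nat (real_complex R)) -rmorphM /=; congr (_%:C%C).
    by rewrite mulrC divfK// gt_eqF.
  have [H1|H1] := pselect (Gamma (z - (s - N.+1%:R * (z - x 1)))).
    exists (x 2); split; first by apply: xG; lra.
    move=> H2; have := latticeB H1 H2; rewrite !mulrBr !Nx.
    have -> : forall q r u : C, z - (s - (q - r)) - (z - (s - (q - u))) = u - r.
      by move=> *; ring.
    rewrite -mulrBl -rmorphB; apply: (lattice_scal w_indep); lra.
  by exists (x 1); split => //; apply: xG; lra.
have [f fV fz] := H (z - x); exists f => //; apply/eqP => /fz[//|[_]].
by rewrite opprB addrC subrK.
Qed.

End ThetaFunctions.

Lemma theta_nonvanishing {R : realType} (nu : R) (w1 w2 : R[i]) (chi : R[i] -> R[i]) :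
  0 < nu -> R_independent w1 w2 -> pseudo_character nu (lattice w1 w2) chi ->
  exists s : R[i], forall z, ~ lattice w1 w2 (z - s) ->
  exists2 f, theta_space nu (lattice w1 w2) chi f & f z != 0.
Proof.
move=> nu0 ind; have := oriented_area_neq0 ind; rewrite neq_lt => /orP[A0|A0] chiP; last first.
  exact: theta_nonvanishing_oriented.
(* Swapping the generators keeps the lattice and reverses the orientation. *)
rewrite latticeC; rewrite latticeC in chiP.
apply: theta_nonvanishing_oriented => //; first exact: R_independentC.
by rewrite oriented_areaC oppr_gt0.
Qed.

(** * Zeros of the kernel *)

Section Discreteness.
Context {R : realType}.
Local Notation C := (R[i]).
Local Notation nc := (@Normc.normc R).

(** Up to sign, the imaginary part of [conjc w * x] is the area times one coordinate of [x]: the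
    first for [w = w2], the second for [w = w1]. A bound on [x] thus bounds both integers. *)
Lemma lattice_ball_finite (w1 w2 : C) (M : R) : R_independent w1 w2 ->
  finite_set [set x | lattice w1 w2 x /\ nc x <= M].
Proof.
move=> ind; have A0 := oriented_area_neq0 ind.
pose A := `|oriented_area w1 w2|.
have A_gt0 : 0 < A by rewrite normr_gt0.
(* The absolute value makes the argument of [Num.bound] nonnegative even when [M] is negative. *)
pose B := Num.bound ((nc w1 + nc w2) * `|M| / A).
pose I := [set m : int | (`|m| <= B)%N].
have fI : finite_set I.
  apply: (@sub_finite_set _ _ ((Posz @` `I_B.+1) `|` ((fun n => - Posz n) @` `I_B.+1))).
    move=> m /= Im; case: (intP m) Im => [|n|n] /= Im.
    - by left; exists 0%N.
    - by left; exists n.+1.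
    - by right; exists n.+1 => //; move: Im; rewrite abszN.
  by rewrite finite_setU; split; apply: finite_image; exact: finite_II.
apply: (@sub_finite_set _ _ [set w1 *~ m + w2 *~ n | m in I & n in I]); last exact: finite_image2.
move=> _ [[m [n ->]] nM].
set x := w1 *~ m + w2 *~ n in nM.
have bound (k : int) (w : C) : nc w <= nc w1 + nc w2 ->
    `|complex.Im (conjc w * x)| = A * `|k|%N%:R -> I k.
  move=> ww E; rewrite /I /= -(ler_nat R).
  have H : A * `|k|%N%:R <= (nc w1 + nc w2) * `|M|.
    rewrite -E (le_trans (normr_Im_le _))// Normc.normcM.
    have -> : nc (conjc w) = nc w by apply: complexI; rewrite -!ncE normcJ.
    by rewrite ler_pM ?nc_ge0// (le_trans nM)// ler_norm.
  apply/ltW/(le_lt_trans _ (archi_boundP _)).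
    by rewrite ler_pdivlMr// mulrC.
  by rewrite divr_ge0 ?(ltW A_gt0)// mulr_ge0// addr_ge0// nc_ge0.
have xE : x = m%:~R * w1 + n%:~R * w2 by rewrite !mulrzl.
exists m; last exists n => //.
- apply: (bound _ w2); first by rewrite lerDr nc_ge0.
  rewrite /A -normrN -oriented_areaC /oriented_area natr_absz intr_norm -normrM; congr `|_|.
  rewrite xE -!intr_real; case: (w1) (w2) => [a b] [c d] /=; ring.
- apply: (bound _ w1); first by rewrite lerDl nc_ge0.
  rewrite /A /oriented_area natr_absz intr_norm -normrM; congr `|_|.
  rewrite xE -!intr_real; case: (w1) (w2) => [a b] [c d] /=; ring.
Qed.

Lemma compact_nc_bounded (L : set C) : compact (L : set C^o) ->
  exists M : R, forall z, L z -> nc z <= M.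
Proof.
move=> cL.
have cont : continuous (nc : C^o -> R).
  move=> z; apply/(@cvgrPdist_lt _ _ _ _ (nbhs_filter (z : C^o))) => e e0; apply/nbhs_ballP.
  exists (e%:C%C) => /=; first by rewrite ltcR.
  move=> y; rewrite /ball /= ncE ltcR; apply: le_lt_trans.
  have H1 := ncD (z - y) y; have H2 := ncD (y - z) z.
  move: H1 H2; rewrite !subrK -[nc (y - z)]ncN opprB ler_norml => H1 H2.
  by apply/andP; split; lra.
have [M [_ HM]] := compact_bounded (continuous_compact (continuous_subspaceT cont) cL).
(* Boundedness is provided only for constants strictly above [M]. *)
exists (M + 1) => z Lz.
have MM : M < M + 1 by rewrite ltrDl.
apply: le_trans (ler_norm _) _; apply: (HM _ MM); by exists z.
Qed.

Lemma lattice_coset_compact_finite (w1 w2 s : C) (L : set C) :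
  R_independent w1 w2 -> compact (L : set C^o) ->
  finite_set [set z | L z /\ lattice w1 w2 (z - s)].
Proof.
move=> ind /compact_nc_bounded[M HM].
apply: (@sub_finite_set _ _ ((fun x => x + s) @` [set x | lattice w1 w2 x /\ nc x <= M + nc s])).
  move=> z /= [Lz Gz]; exists (z - s); last by rewrite subrK.
  split=> //; apply: (le_trans (ncD _ _)); rewrite ncN lerD2r; exact: HM.
by apply: finite_image; exact: lattice_ball_finite.
Qed.

End Discreteness.

(** * Hermitian symmetry, the zeros of the kernel and the common zeros of the space *)

Section Kernel.
Context {R : realType}.
Local Notation C := (R[i]).
Local Notation nc := (@Normc.normc R).

(* If the integral diverges then [fine] sends both sides to [0]. *)
Lemma RintegralN d (T : measurableType d) (mu : {measure set T -> \bar R})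
    (D : set T) (f : T -> R) :
  \int[mu]_(x in D) (- f x) = - \int[mu]_(x in D) f x.
Proof.
pose g x := (f x)%:E.
have -> : \int[mu]_(x in D) (- f x) = fine (\int[mu]_(x in D) (\- g) x)%E by [].
have -> : \int[mu]_(x in D) f x = fine (\int[mu]_(x in D) g x)%E by [].
rewrite (integralE mu D g) (integralE mu D (\- g)%E) funeposN funenegN.
move: (integral mu D g^\+%E) (integral mu D g^\-%E).
by move=> [a| |] [b| |] //=; rewrite ?oppr0// opprB.
Qed.

Lemma cintegral_conj (A : set C) (f : C -> C) :
  cintegral A (fun z => conjc (f z)) = conjc (cintegral A f).
Proof.
rewrite /cintegral /=; apply/eqP; rewrite eq_complex /= -RintegralN.
apply/andP; split; apply/eqP; congr Rintegral; apply/funext => p; by case: (f _).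
Qed.

Lemma cexp_conj (z : C) : cexp (conjc z) = conjc (cexp z).
Proof. by case: z => a b; rewrite /cexp /= cosN sinN mulrN. Qed.

Lemma theta_inner_conj nu (L : set C) (f g : C -> C) :
  theta_inner nu L g f = conjc (theta_inner nu L f g).
Proof.
rewrite /theta_inner -cintegral_conj; congr cintegral; apply/funext => z.
have real_weight : conjc (cexp (- (nu%:C%C * `|z| ^+ 2))) = cexp (- (nu%:C%C * `|z| ^+ 2)).
  rewrite -cexp_conj; congr cexp.
  have -> : - (nu%:C%C * `|z| ^+ 2) = (- (nu * nc z ^+ 2))%:C%C.
    by rewrite rmorphN rmorphM rmorphXn.
  exact: conjc_real.
move: (cexp _) real_weight => c cE.
by rewrite !rmorphM /= conjcK cE [conjc (f z) * _]mulrC.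
Qed.

Variables (nu : R) (w1 w2 : C) (chi : C -> C) (Lambda0 : set C) (K : C -> C -> C).
Local Notation Gamma := (lattice w1 w2).
Local Notation V := (theta_space nu Gamma chi).
Hypothesis KP : reproducing_kernel nu Gamma chi Lambda0 K.

(** Reproducing the section at [w] in the point [z] gives the inner product of two kernel sections;
    exchanging [z] and [w] exchanges its arguments. *)
Lemma kernel_hermitian z w : K z w = conjc (K w z).
Proof.
have [KV Krep] := KP.
by rewrite (Krep _ z (KV w)) (Krep _ w (KV z)) theta_inner_conj.
Qed.

Lemma kernel_eq0C z w : K z w = 0 -> K w z = 0.
Proof. by rewrite kernel_hermitian => /eqP; rewrite conjc_eq0 => /eqP. Qed.

Lemma kernel_eq0_shift z w gamma : Gamma gamma -> K z w = 0 -> K (z + gamma) w = 0.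
Proof. by move=> G Kzw; rewrite (KP.1 w).2// Kzw mulr0. Qed.

Lemma kernel_eq0_unshift z w gamma : Gamma gamma -> K (z + gamma) w = 0 -> K z w = 0.
Proof.
by move=> G /(kernel_eq0_shift (latticeN G)); rewrite addrK.
Qed.

Lemma cell_cover (Lambda : set C) z : fundamental_cell Gamma Lambda ->
  exists2 x, Lambda x & exists2 gamma, Gamma gamma & z = x + gamma.
Proof.
move=> [_ cov _]; have : [set: C] z by [].
by rewrite -cov => -[x Lx [gamma G <-]]; exists x => //; exists gamma.
Qed.

Lemma Xi_kernel_eq0 (Lambda : set C) w : fundamental_cell Gamma Lambda ->
  Xi Lambda K w -> forall z, K z w = 0.
Proof.
move=> hL [_ Kw] z; have [x Lx [gamma G ->]] := cell_cover z hL.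
by apply: kernel_eq0_shift => //; exact: Kw.
Qed.

Lemma analytic_setE (Lambda : set C) : fundamental_cell Gamma Lambda ->
  analytic_set Lambda V = Xi Lambda K.
Proof.
move=> hL; apply/seteqP; split => w.
  (* Membership in [Lambda] is read off from one member of the family, here the kernel section at
     0. *)
  move=> Hw; split; first by have [] := Hw _ (KP.1 0).
  by move=> z _; apply: kernel_eq0C; have [_] := Hw _ (KP.1 z).
move=> Xw f Vf; split; first exact: Xw.1.
rewrite /zeros /= (KP.2 _ w Vf) /theta_inner.
have -> : (fun z => f z * conjc (K z w) * cexp (- (nu%:C%C * `|z| ^+ 2))) = (fun=> 0).
  by apply/funext => z; rewrite (Xi_kernel_eq0 hL Xw) conjc0 mulr0 mul0r.
rewrite /cintegral /Rintegral /=.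
by rewrite integral0_eq.
Qed.

(** The coordinate known to lie in the cell becomes the index of the union; the other is translated
    into the cell, after exchanging coordinates if it is the second. *)
Lemma kernel_zeros_cellE (Lambda : set C) : fundamental_cell Gamma Lambda ->
  kernel_zeros K `&` (Lambda `*` setT `|` setT `*` Lambda) =
    kernel_zeros_from_cell Gamma Lambda K.
Proof.
move=> hL; apply/seteqP; split => -[z w].
  move=> [/= Kzw [[/= Lz _]|[/= _ Lw]]].
    have [x Lx [gamma G wE]] := cell_cover w hL.
    right; exists z => //; split => //=; exists x; last by exists gamma.
    split=> //; apply: (kernel_eq0_unshift G); rewrite -wE; exact: kernel_eq0C.
  have [x Lx [gamma G zE]] := cell_cover z hL.
  left; exists w => //; split => //=; exists x; last by exists gamma.
  by split=> //; apply: (kernel_eq0_unshift G); rewrite -zE.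
move=> [] [v Lv [/=]].
  move=> [x [Lx Kx] [gamma G <-]] ->; split; last by right.
  exact: kernel_eq0_shift.
move=> -> [x [Lx Kx] [gamma G <-]]; split; last by left.
by apply: kernel_eq0C; exact: kernel_eq0_shift.
Qed.

Lemma kernel_zeros_saturationE (Lambda : set C) : fundamental_cell Gamma Lambda ->
  kernel_zeros K = saturation Gamma (kernel_zeros_from_cell Gamma Lambda K).
Proof.
move=> hL; rewrite -kernel_zeros_cellE//; apply/seteqP; split => -[z w].
  move=> /= Kzw; have [y Ly [gamma' G' wE]] := cell_cover w hL.
  (* Moving the second coordinate into the cell is enough, so the first is translated by 0. *)
  exists (z, y); split; last first.
    by exists 0, gamma'; split => //=; [exact: lattice0|rewrite addr0 wE].
  split; last by right.
  by apply: kernel_eq0C; apply: (kernel_eq0_unshift G'); rewrite -wE; exact: kernel_eq0C.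
move=> [[x y] [[/= Kxy _] [gamma [gamma' [G G' [-> ->]]]]]] /=.
apply: kernel_eq0_shift => //; apply: kernel_eq0C; apply: kernel_eq0_shift => //.
exact: kernel_eq0C.
Qed.

End Kernel.

Theorem theorem2p1 (R : realType) (w1 w2 : R[i]) (nu : R)
    (chi : R[i] -> R[i]) (Lambda0 : set R[i]) (K : R[i] -> R[i] -> R[i])
    (d : nat)
    (hw : R_independent w1 w2) (hnu : 0 < nu)
    (hchi : pseudo_character nu (lattice w1 w2) chi)
    (hLambda0 : fundamental_cell (lattice w1 w2) Lambda0)
    (hK : reproducing_kernel nu (lattice w1 w2) chi Lambda0 K)
    (hd : has_dimension (theta_space nu (lattice w1 w2) chi) d) :
  symmetric_set (kernel_zeros K) /\
  forall Lambda : set R[i], fundamental_cell (lattice w1 w2) Lambda ->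
    [/\ kernel_zeros K `&` (Lambda `*` setT `|` setT `*` Lambda) =
          kernel_zeros_from_cell (lattice w1 w2) Lambda K,
        kernel_zeros K =
          saturation (lattice w1 w2)
            (kernel_zeros_from_cell (lattice w1 w2) Lambda K),
        analytic_set Lambda (theta_space nu (lattice w1 w2) chi) = Xi Lambda K,
        finite_set (Xi Lambda K)
      & (classes_mod (lattice w1 w2) (Xi Lambda K) #<= `I_d)%card].
Proof.
split; first by move=> z w; exact: (kernel_eq0C hK).
move=> Lambda hL.
have [s Hs] := theta_nonvanishing hnu hw hchi.
have XiE := analytic_setE hK hL.
(* Off the class of [s] some theta function is nonzero, so a common zero must lie in that class. *)
have Xi_coset z : Xi Lambda K z -> lattice w1 w2 (z - s).
  move=> Xz; apply: contrapT => /Hs[f Vf]; apply/negP; rewrite negbK.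
  by move: Xz; rewrite -XiE => /(_ f Vf)[_ fz]; apply/eqP.
(* The point [s + w1 / 2] is off the class of [s], so the space has a nonzero element, which no
   empty basis can produce. *)
have d_gt0 : (0 < d)%N.
  have [f Vf fz] : exists2 f, theta_space nu (lattice w1 w2) chi f &
      f (s + (1 / 2 : R)%:C%C * w1) != 0.
    apply: Hs; rewrite addrC addKr; apply: (lattice_scal hw); lra.
  have [e [_ _ /(_ f Vf)[c fE]]] := hd.
  by case: d e c fE {hd} => // e c fE; move: fz; rewrite fE big_ord0 eqxx.
split=> //.
- exact: (kernel_zeros_cellE hK hL).
- exact: (kernel_zeros_saturationE hK hL).
- have [cL _ _] := hL.
  apply: (sub_finite_set _ (lattice_coset_compact_finite s hw cL)).
  by move=> z Xz; split; [exact: Xz.1|exact: Xi_coset].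
(* There is at most one class, that of [s], and [d] is at least 1. *)
- have sub : classes_mod (lattice w1 w2) (Xi Lambda K) `<=`
      [set Defs.msum [set s] (lattice w1 w2)].
    move=> _ [w /Xi_coset Gw <-] /=.
    apply/seteqP; split => _ [_ -> [gamma G <-]].
      exists s => //; exists (w - s + gamma); first exact: latticeD.
      by rewrite addrA addrC [s + _]addrC subrK addrC.
    exists w => //; exists (s - w + gamma); last by rewrite addrA [w + _]addrC subrK.
    by apply: latticeD => //; rewrite -opprB; exact: latticeN.
  apply: card_le_trans (subset_card_le sub) _.
  by rewrite (card_le_eql card_set1) card_le_II.
Qed.
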